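(* For all integers $r,a$ with $r\ge 1$ and $0\le a\le r$, we have $$\sum_{\substack{(k_1,\ldots,k_r)\in\{1,2\}^r\\ \#\{i:\,k_i=2\}=a}}\left(2^a(-1)^{\#\{i:\ i\text{ odd},\ k_i=2\}}-1\right)\zeta_{\mathcal{A}}^{(2)}(k_1,\ldots,k_r)=0$$ in the ring $\mathcal{A}$.
   Context: Let $\mathcal{P}$ be the set of primes and let $\mathcal{A}$ be the quotient ring $$\mathcal{A}=\prod_{p\in\mathcal{P}}\mathbb{Z}/p\mathbb{Z}\Big/\bigoplus_{p\in\mathcal{P}}\mathbb{Z}/p\mathbb{Z},$$ so that two families $(a_p)_p$ and $(b_p)_p$ define the same element of $\mathcal{A}$ if and only if $a_p=b_p$ for all but finitely many primes $p$. For a tuple of positive integers $\boldsymbol{k}=(k_1,\ldots,k_r)$, the finite multiple zeta value of level two is $$\zeta_{\mathcal{A}}^{(2)}(\boldsymbol{k})=\left(\sum_{1\leq m_1<\cdots<m_r<p/2}\frac{1}{m_1^{k_1}\cdots m_r^{k_r}}\bmod p\right)_p\in\mathcal{A},$$ where the sum is over integers $m_1,\ldots,m_r$ (an empty sum is $0$). *)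

(* Defs.v *)
From HB Require Import structures.
From mathcomp Require Import all_boot all_order all_algebra.
From mathcomp Require Import boolp classical_sets functions cardinality.

Set Implicit Arguments.
Unset Strict Implicit.
Unset Printing Implicit Defensive.

Import GRing.Theory.
Local Open Scope ring_scope.
Local Open Scope classical_set_scope.
Local Open Scope quotient_scope.

Definition primeT : Type := {p : nat | prime p}.

Definition prodFp : Type := forall p : primeT, 'F_(val p).

HB.instance Definition _ := Choice.copy prodFp (forall p : primeT, 'F_(val p)).

Section ProdRing.
Implicit Types f g h : prodFp.

Definition prodFp_zero : prodFp := fun=> 0.
Definition prodFp_one : prodFp := fun=> 1.
Definition prodFp_opp f : prodFp := fun p => - f p.
Definition prodFp_add f g : prodFp := fun p => f p + g p.
Definition prodFp_mul f g : prodFp := fun p => f p * g p.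

Let addA : associative prodFp_add.
Proof. by move=> f g h; apply: functional_extensionality_dep => p; exact: addrA. Qed.
Let addC : commutative prodFp_add.
Proof. by move=> f g; apply: functional_extensionality_dep => p; exact: addrC. Qed.
Let add0 : left_id prodFp_zero prodFp_add.
Proof. by move=> f; apply: functional_extensionality_dep => p; exact: add0r. Qed.
Let addN : left_inverse prodFp_zero prodFp_opp prodFp_add.
Proof. by move=> f; apply: functional_extensionality_dep => p; exact: addNr. Qed.

HB.instance Definition _ := GRing.isZmodule.Build prodFp addA addC add0 addN.

Let mulA : associative prodFp_mul.
Proof. by move=> f g h; apply: functional_extensionality_dep => p; exact: mulrA. Qed.
Let mulC : commutative prodFp_mul.
Proof. by move=> f g; apply: functional_extensionality_dep => p; exact: mulrC. Qed.
Let mul1 : left_id prodFp_one prodFp_mul.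
Proof. by move=> f; apply: functional_extensionality_dep => p; exact: mul1r. Qed.
Let mulDl : left_distributive prodFp_mul prodFp_add.
Proof. by move=> f g h; apply: functional_extensionality_dep => p; exact: mulrDl. Qed.
Let one_neq0 : prodFp_one != prodFp_zero.
Proof.
apply/eqP => /(congr1 (fun f : prodFp => f (exist _ 2%N isT))).
by move/eqP; rewrite oner_eq0.
Qed.

HB.instance Definition _ :=
  GRing.Zmodule_isComNzRing.Build prodFp mulA mulC mul1 mulDl one_neq0.

End ProdRing.

(* The ideal of families with finite support, i.e. the direct sum. *)
Definition sumFp : {pred prodFp} :=
  fun f => `[< finite_set [set p : primeT | f p != 0] >].

Lemma sumFpP (f : prodFp) :
  reflect (finite_set [set p : primeT | f p != 0]) (f \in sumFp).
Proof. exact: asboolP. Qed.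

Lemma infinite_primeT : ~ finite_set [set: primeT].
Proof.
move=> /(finite_image (fun p : primeT => val p)) /finite_seqP [s sE].
have [q lt_q pr_q] := prime_above (\max_(i <- s) i).
have q_s : q \in s.
  suff : [set` s] q by [].
  by rewrite -sE; exists (exist (fun p => prime p) q pr_q).
by move: lt_q; rewrite ltnNge (leq_bigmax_seq (F := id)).
Qed.

Lemma sumFp_idealr_closed : idealr_closed sumFp.
Proof.
split=> [||h f g /sumFpP fF /sumFpP gF]; apply/sumFpP.
- by rewrite (_ : [set _ | _] = set0) // -subset0 => p.
- move=> F1; apply: infinite_primeT.
  by apply: sub_finite_set F1 => p _; exact: (oner_neq0 'F_(val p)).
apply: (@sub_finite_set _ _
  ([set p : primeT | f p != 0] `|` [set p : primeT | g p != 0])).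
  move=> p /=; case: (eqVneq (f p) 0) => [f0|]; last by left.
  case: (eqVneq (g p) 0) => [g0|]; last by right.
  by rewrite (_ : (h * f + g) p = h p * f p + g p) // f0 g0 mulr0 addr0 eqxx.
by rewrite finite_setU.
Qed.

HB.instance Definition _ := isIdealr.Build prodFp sumFp sumFp_idealr_closed.

Definition ringA : comNzRingType := {ideal_quot sumFp}.

Definition toA (f : prodFp) : ringA := \pi_{ideal_quot sumFp} f.

Lemma toA_eqP (f g : prodFp) :
  toA f = toA g <-> finite_set [set p : primeT | f p != g p].
Proof.
have E : [set p : primeT | (f - g) p != 0] = [set p : primeT | f p != g p].
  by apply/seteqP; split=> p /=; rewrite (_ : (f - g) p = f p - g p) // subr_eq0.
rewrite /toA; split=> [/eqP|h].
  by rewrite -Quotient.idealrBE => /sumFpP; rewrite E.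
by apply/eqP; rewrite -Quotient.idealrBE; apply/sumFpP; rewrite E.
Qed.

(* Meant for positive [k].  Indices are 0-based: [m i] and [k i] stand for
   $m_{i+1}$ and $k_{i+1}$.  The bound m < p/2 is the rational one, hence
   [2 * m < p]; as 1 <= m < p, only nonzero elements are inverted. *)
Definition zeta2_mod (r : nat) (k : 'I_r -> nat) : prodFp := fun p =>
  \sum_(m : {ffun 'I_r -> 'I_(val p)} |
      [forall i : 'I_r, (1 <= m i)%N && (2 * m i < val p)%N]
      && [forall i : 'I_r, forall j : 'I_r, (i < j)%N ==> (m i < m j)%N])
    \prod_(i < r) ((m i)%:R ^+ k i)^-1.

Definition zetaA2 (r : nat) (k : 'I_r -> nat) : ringA := toA (zeta2_mod k).

(* Main.v *)
Require Import Defs.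
From HB Require Import structures.
From mathcomp Require Import all_boot all_order all_algebra.
From mathcomp Require Import ring.
From mathcomp Require Import boolp classical_sets cardinality.

Import GRing.Theory.
Local Open Scope ring_scope.

(** Fix an odd prime p and put n = (p - 1) / 2, so that the sums run over
    1 <= m_1 < ... < m_r <= n.  Summing over all k at once, with a weight Y^a
    recording the number a of entries equal to 2, turns the claim into an
    equality of two ordered sums with polynomial weights: weight
    1/m + 2 (-1)^i Y/m^2 at the (1-based) position i on one side, weight
    1/m + Y/m^2 on the other (lemma [coef_isum]).  Sum further over r with
    weight X^r and replace XY by Y.  The unsigned side becomes the product of
    the factors 1 + X/m + Y/m^2, m <= n.  On the signed side the sign depends
    on the parity of the position only, so the generating function S_n is
    computed together with its companion D_n, in which the tuples of odd length
    are counted negatively, by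
      S_m = (1 + X/m) S_{m-1} - 2Y/m^2 D_{m-1},
      D_m = (1 - X/m) D_{m-1} + 2Y/m^2 S_{m-1},   S_0 = D_0 = 1
    ([coef_chain_isum]).  What has to be shown is that, modulo p, S_n is that
    product.

    The reason is an identity valid in every field where 1, ..., 2n are
    invertible.  Put c_m = (n - m + 1) / (n + m) and deform the recursion to
      S_m = (1 + X/m) S_{m-1} + 2Y/m^2 c_m D_{m-1},
      D_m = 2Y/m^2 S_{m-1} - (1 - X/m) c_m D_{m-1}.
    If p = 2n + 1 = 0 in the field, then c_m = -1 and this is the recursion
    above.  But now n can vary.  Write S_m(n) for the solution with parameter n; the
    solutions for n and n + 1 are related by a 2 x 2 matrix with explicit
    rational entries ([transport]), and the relation at m = n, followed by the
    last step of the recursion for n + 1, gives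
      S_{n+1}(n+1) = (1 + X/(n+1) + Y/(n+1)^2) S_n(n),
    whence the product formula [fchain_diag].

    The formula is applied in the field of fractions of F_p[Y][X] and then read
    off coefficient by coefficient.  It fails to apply only at p = 2, which is
    invisible in the quotient ring. *)

(** * The deformed recursion and its product formula *)

(** [v m] stands for 1/m; keeping it abstract lets the recursion live in a
    polynomial ring as well as in a field. *)
Fixpoint chain (R : comPzRingType) (v c : nat -> R) (X Y : R) (m : nat) : R * R :=
  if m is m'.+1 then
    let q := chain R v c X Y m' in
    ((1 + X * v m) * q.1 + 2%:R * Y * v m ^+ 2 * c m * q.2,
     2%:R * Y * v m ^+ 2 * q.1 - (1 - X * v m) * c m * q.2)
  else (1, 1).
Arguments chain {R}.

Definition ratio (K : fieldType) (n m : nat) : K := (n%:R - m%:R + 1) / (n%:R + m%:R).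
Arguments ratio {K}.

Definition fchain (K : fieldType) (X Y : K) (n : nat) :=
  chain (fun m => m%:R^-1) (ratio n) X Y.
Arguments fchain {K}.

Lemma natr_predE (R : pzRingType) (n : nat) : n%:R = n.+1%:R - 1 :> R.
Proof. by rewrite -natr1 addrK. Qed.

(** The matrix can be found as follows.  The first row has to be
    (1 + X/N, Y/N^3) at m = n for the product formula to follow, and its sum has
    to be 1 + X/N + Y/N^2 at m = 0, where all four values are 1.  Keeping its
    first entry constant and interpolating the second one affinely in m, the
    recursion for the first component dictates the second row.  The recursion
    for both components then confirms the relation by induction on m. *)
Lemma transport (K : fieldType) (X Y : K) (n m : nat) :
  (forall i, (0 < i <= n.+1 + m)%N -> i%:R != 0 :> K) ->
  let N : K := n.+1%:R in let M : K := m%:R in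
  let q := fchain X Y n m in let q' := fchain X Y n.+1 m in
  (1 + X / N + Y / N ^+ 2) * q.1
    = (1 + X / N) * q'.1 + Y * (N - M) / N ^+ 3 * q'.2 /\
  (1 + X / N + Y / N ^+ 2) * q.2
    = Y * (N + M) / N ^+ 3 * q'.1 + (1 + X / N) * (N ^+ 2 - M ^+ 2) / N ^+ 2 * q'.2.
Proof.
elim: m => [|m IHm] nz N M q q'.
  have N0 : N != 0 by apply: nz; rewrite addn0 ltnSn.
  by rewrite /q /q' /M /= {nz q q' M}; clearbody N; split; field; rewrite N0.
have N0 : N != 0 by apply: nz; rewrite leq_addr.
have M0 : M != 0 by apply: nz; rewrite leq_addl.
have NM0 : N + M != 0 by rewrite -natrD; apply: nz; rewrite leqnn.
have NM1 : N - 1 + M != 0.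
  by rewrite /N -natr_predE -natrD; apply: nz; rewrite addSn leqnSn addnS.
have nz' i : (0 < i <= n.+1 + m)%N -> i%:R != 0 :> K.
  by case/andP=> i0 hi; apply: nz; rewrite i0 addnS (leq_trans hi).
move: (IHm nz') => {IHm nz nz'}.
rewrite /q /q' /fchain /= -/(fchain X Y n m) -/(fchain X Y n.+1 m) /ratio.
rewrite -/N -/M [n%:R]natr_predE [m%:R]natr_predE -/N -/M.
case: (fchain X Y n m) => s d; case: (fchain X Y n.+1 m) => s' d' /= [Hs Hd].
clearbody N M; split.
- rewrite mulrDr mulrCA Hs [X in _ + X]mulrCA Hd.
  by field; rewrite ?N0 ?M0 ?NM0.
- rewrite mulrBr mulrCA Hs [X in _ - X]mulrCA Hd.
  by field; rewrite ?N0 ?M0 ?NM0.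
Qed.

(** For the parameter n + 1 the last ratio is 1/(2(n+1)), so the last step of
    the recursion computes exactly the first row of [transport] at m = n. *)
Lemma fchain_diag (K : fieldType) (X Y : K) (n : nat) :
  (forall i, (0 < i <= n.*2)%N -> i%:R != 0 :> K) ->
  (fchain X Y n n).1 = \prod_(m < n) (1 + X / m.+1%:R + Y / m.+1%:R ^+ 2).
Proof.
elim: n => [|n IHn] nz; first by rewrite big_ord0.
have N0 : (n.+1%:R : K) != 0.
  by apply: nz; rewrite -addnn leq_addr.
have NN0 : (n.+1%:R + n.+1%:R : K) != 0.
  by rewrite -natrD addnn; apply: nz; rewrite doubleS leqnn.
rewrite big_ord_recr /= -IHn; last first.
  move=> i /andP[i0 hi]; apply: nz.
  by rewrite i0 (leq_trans hi) // doubleS -addn2 leq_addr.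
have [|Hs _] := @transport K X Y n n.
  by move=> i /andP[i0 hi]; apply: nz; rewrite i0 (leq_trans hi) // addSn addnn doubleS.
rewrite [RHS]mulrC Hs /fchain /= -/(fchain X Y n.+1 n) /ratio [n%:R]natr_predE.
move: (n.+1%:R : K) N0 NN0 => N N0 NN0.
by field; rewrite N0 NN0.
Qed.

Lemma rmorph_chain (R R' : comPzRingType) (f : {rmorphism R -> R'})
    (v c : nat -> R) (X Y : R) (m : nat) :
  chain (f \o v) (f \o c) (f X) (f Y) m =
    (f (chain v c X Y m).1, f (chain v c X Y m).2).
Proof.
elim: m => [|m /= ->] /=; first by rewrite rmorph1.
by rewrite !(rmorphD, rmorphB, rmorphN, rmorphM, rmorphXn, rmorph1, rmorph_nat).
Qed.

Lemma eq_chain (R : comPzRingType) (v v' c c' : nat -> R) (X Y : R) (m : nat) :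
  (forall i, (0 < i <= m)%N -> v i = v' i) ->
  (forall i, (0 < i <= m)%N -> c i = c' i) ->
  chain v c X Y m = chain v' c' X Y m.
Proof.
elim: m => // m IHm eqv eqc /=.
rewrite IHm ?eqv ?eqc ?ltnSn // => i /andP[i0 im]; by rewrite ?eqv ?eqc // i0 ltnW.
Qed.

(** * Sums over increasing tuples *)

Definition increasing (p r : nat) (m : {ffun 'I_r -> 'I_p}) : bool :=
  [forall i : 'I_r, forall j : 'I_r, (i < j)%N ==> (m i < m j)%N].

(** The strict bound on the entries is N; p merely provides a finite type for
    them, so that N can vary in a recursion while the index type stays fixed. *)
Definition isum (R : pzSemiRingType) (p r N : nat) (g : nat -> nat -> R) : R :=
  \sum_(m : {ffun 'I_r -> 'I_p} |
      [forall i : 'I_r, (0 < m i < N)%N] && increasing p r m)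
    \prod_(i < r) g i (m i).
Arguments isum {R}.

Lemma isum0 (R : pzSemiRingType) (p N : nat) (g : nat -> nat -> R) : isum p 0 N g = 1.
Proof.
rewrite /isum (eq_bigl predT) => [|m]; last first.
  by apply/andP; split; apply/forallP => - [].
rewrite (eq_bigr (fun=> 1)) => [|m _]; last by rewrite big_ord0.
by rewrite sumr_const card_ffun !card_ord expn0.
Qed.

Definition snoc (T : Type) (r : nat) (m : {ffun 'I_r -> T}) (b : T) : {ffun 'I_r.+1 -> T} :=
  [ffun i => if unlift ord_max i is Some j then m j else b].
Arguments snoc {T r}.

Lemma snoc_max (T : Type) (r : nat) (m : {ffun 'I_r -> T}) (b : T) :
  snoc m b ord_max = b.
Proof. by rewrite ffunE unlift_none. Qed.

Lemma snoc_lift (T : Type) (r : nat) (m : {ffun 'I_r -> T}) (b : T) (j : 'I_r) :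
  snoc m b (lift ord_max j) = m j.
Proof. by rewrite ffunE liftK. Qed.

Lemma forall_ord_recr (r : nat) (P : pred 'I_r.+1) :
  [forall i, P i] = [forall j, P (lift ord_max j)] && P ord_max.
Proof.
apply/forallP/andP => [Pa | [/forallP Pl Pm] i]; first by split=> //; apply/forallP.
by case: (unliftP ord_max i) => [j|] ->.
Qed.

Lemma prod_snoc (R : pzSemiRingType) (T : Type) (r : nat) (m : {ffun 'I_r -> T})
    (b : T) (g : nat -> T -> R) :
  \prod_(i < r.+1) g i (snoc m b i) = (\prod_(i < r) g i (m i)) * g r b.
Proof.
rewrite big_ord_recr /= snoc_max; congr (_ * _); apply: eq_bigr => i _.
have -> : widen_ord (leqnSn r) i = lift ord_max i by apply: ord_inj; rewrite lift_max.
by rewrite snoc_lift.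
Qed.

Lemma increasing_snoc (p r : nat) (m : {ffun 'I_r -> 'I_p}) (b : 'I_p) :
  increasing p r.+1 (snoc m b) = increasing p r m && [forall i, (m i < b)%N].
Proof.
apply/forallP/andP => [inc | [/forallP inc /forallP mb] i].
  split; apply/forallP => i; last first.
    have /forallP/(_ ord_max) := inc (lift ord_max i).
    by rewrite snoc_lift snoc_max lift_max ltn_ord.
  apply/forallP => j; have /forallP/(_ (lift ord_max j)) := inc (lift ord_max i).
  by rewrite !snoc_lift !lift_max.
apply/forallP => j; case: (unliftP ord_max i) => [i'|] ->; last first.
  by rewrite ltnNge -ltnS ltn_ord.
case: (unliftP ord_max j) => [j'|] ->; last by rewrite snoc_lift snoc_max mb implybT.
by rewrite !snoc_lift !lift_max; have /forallP := inc i'; apply.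
Qed.

(** Peel off the last and largest entry b; the others are increasing below b. *)
Lemma isumS (R : comPzSemiRingType) (p r N : nat) (g : nat -> nat -> R) :
  isum p r.+1 N g = \sum_(b < p | (0 < b < N)%N) isum p r b g * g r b.
Proof.
rewrite /isum.
rewrite (reindex (fun mb : {ffun 'I_r -> 'I_p} * 'I_p => snoc mb.1 mb.2)) /=; last first.
  exists (fun m => ([ffun j => m (lift ord_max j)], m ord_max)) => [[m b]|m] _ /=.
    by congr pair; rewrite ?snoc_max //; apply/ffunP=> j; rewrite ffunE snoc_lift.
  apply/ffunP => i; rewrite ffunE; case: unliftP => [j|] -> //; by rewrite ffunE.
under eq_bigr => mb _ do rewrite (prod_snoc _ _ _ _ _ (fun i x => g i (nat_of_ord x))).
under [RHS]eq_bigr => b _ do rewrite mulr_suml.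
rewrite (exchange_big_dep xpredT) //= pair_big_dep /=.
apply: eq_bigl => -[m b] /=.
rewrite forall_ord_recr snoc_max.
under eq_forallb => j do rewrite snoc_lift.
rewrite increasing_snoc.
apply/andP/andP => [[/andP[/forallP mN ->] /andP[-> /forallP mb]]|].
  by split=> //; rewrite andbT; apply/forallP => i; rewrite mb andbT; case/andP: (mN i).
case=> bN /andP[/forallP mb ->]; split; last by apply/forallP=> i; case/andP: (mb i).
apply/andP; split=> //; apply/forallP=> i; have /andP[H1 H2] := mb i.
by rewrite H1 (leq_trans H2) //; case/andP: bN => _ /ltnW.
Qed.

Lemma isum_recl (R : comPzSemiRingType) (p r N : nat) (g : nat -> nat -> R) :
  (N.+1 < p)%N -> isum p r.+1 N.+2 g = isum p r.+1 N.+1 g + isum p r N.+1 g * g r N.+1.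
Proof.
move=> Np; rewrite !isumS (bigD1 (Ordinal Np)) /= ?ltnSn // addrC; congr +%R.
apply: eq_bigl => b; rewrite -val_eqE /= -andbA [(b < N.+1)%N]ltn_neqAle.
by congr andb; rewrite andbC.
Qed.

Lemma isumS1 (R : comPzSemiRingType) (p r : nat) (g : nat -> nat -> R) : isum p r.+1 1 g = 0.
Proof. by rewrite isumS big_pred0 // => b; case: (b : nat). Qed.

(** * Generating functions in the length of the tuple *)

Lemma coef_prod_isum (R : comNzRingType) (p N r : nat) (g : nat -> R) : (N < p)%N ->
  (\prod_(m < N) (1 + 'X * (g m.+1)%:P))`_r = isum p r N.+1 (fun=> g).
Proof.
elim: N r => [|N IHN] r Np.
  by rewrite big_ord0 coef1; case: r => [|r]; rewrite ?isum0 ?isumS1.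
rewrite big_ord_recr /= mulrDr mulr1 mulrCA mulrA coefD coefMC coefXM.
case: r => [|r]; first by rewrite mul0r addr0 IHN 1?ltnW // !isum0.
by rewrite /= !IHN 1?ltnW // isum_recl.
Qed.

(** In degree r the two components carry the same ordered sum, up to the sign
    (-1)^r.  A step therefore sees the parity of the position at which it
    appends an entry, and this is how the second component produces the
    alternating sign of the quadratic term.  The term 'X * y in place of Y
    makes each entry count once in 'X, whichever summand is chosen. *)
Lemma coef_chain_isum (R : comNzRingType) (p N r : nat) (w : nat -> R) (y : R) :
  (N < p)%N ->
  let q := chain (fun m => (w m)%:P) (fun=> -1) 'X ('X * y%:P) N in
  let z := isum p r N.+1 (fun i m => w m + 2%:R * (-1) ^+ i.+1 * y * w m ^+ 2) in
  q.1`_r = z /\ q.2`_r = (-1) ^+ r * z.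
Proof.
elim: N r => [|N IHN] r Np /=.
  by rewrite coef1; case: r => [|r]; rewrite ?isum0 ?isumS1 ?mulr1 ?mulr0.
have {}IHN := IHN _ (ltnW Np).
move: IHN; set q := chain _ _ _ _ _ => IHN.
have -> : (1 + 'X * (w N.+1)%:P) * q.1 + 2%:R * ('X * y%:P) * (w N.+1)%:P ^+ 2 * -1 * q.2
        = q.1 + 'X * ((w N.+1)%:P * q.1 - (2%:R * y * w N.+1 ^+ 2)%:P * q.2).
  by rewrite !rmorphM /= rmorph_nat; ring.
have -> : 2%:R * ('X * y%:P) * (w N.+1)%:P ^+ 2 * q.1 - (1 - 'X * (w N.+1)%:P) * -1 * q.2
        = q.2 + 'X * ((2%:R * y * w N.+1 ^+ 2)%:P * q.1 - (w N.+1)%:P * q.2).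
  by rewrite !rmorphM /= rmorph_nat; ring.
rewrite !(coefD, coefXM); case: r => [|r].
  by have [-> ->] := IHN 0%N; rewrite !isum0 !addr0 mulr1.
rewrite /= !(coefB, coefD, coefN, coefCM) isum_recl //.
have [-> ->] := IHN r; have [-> ->] := IHN r.+1.
move: (isum _ _ _ _) (isum _ _ _ _) => z z'.
have -> k : (-1) ^+ k.+1 = - (-1) ^+ k :> R by rewrite exprS mulN1r.
have s2 : (-1) ^+ r * (-1) ^+ r = 1 :> R by rewrite -expr2 sqrr_sign.
move: ((-1) ^+ r) s2 => s s2; split; first by ring.
by rewrite -[2%:R * y * _ * z]mul1r -s2; ring.
Qed.

(** * The identity in characteristic p *)

(** The coefficients of the product formula: in characteristic p = 2n + 1 one has
    n - m + 1 = - (n + m), so all the ratios equal -1 and [coef_chain_isum]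
    applies.  The fraction field supplies indeterminates X and Y in a field. *)
Lemma isum_char (F : fieldType) (p r : nat) : p \in [pchar F] -> odd p ->
  isum p r p./2.+1 (fun i m =>
     (m%:R^-1)%:P + 2%:R * (-1) ^+ i.+1 * 'X * (m%:R^-1)%:P ^+ 2) =
  isum p r p./2.+1 (fun _ m =>
     (m%:R^-1)%:P + 'X * (m%:R^-1)%:P ^+ 2) :> {poly F}.
Proof.
move=> pF oddp; set n := p./2.
have pE : p = n.*2.+1 by rewrite -[LHS]odd_double_half oddp.
have np : (n < p)%N by rewrite pE ltnS -addnn leq_addr.
have [<- _] := @coef_chain_isum _ p n r (fun m => (m%:R^-1 : F)%:P) 'X np.
rewrite -coef_prod_isum //; apply: (congr1 (fun P : {poly {poly F}} => P`_r)).
pose K : fieldType := {fraction {poly {poly F}}}.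
pose tf : {rmorphism {poly {poly F}} -> K} := @tofrac {poly {poly F}}.
(* Constants reach K through a morphism from a field, which preserves inverses. *)
pose h : {rmorphism F -> K} := tf \o polyC \o polyC.
have nz i : (0 < i <= n.*2)%N -> i%:R != 0 :> K.
  case/andP=> i0 ilt; rewrite -(rmorph_nat h) fmorph_eq0 -(dvdn_pcharf pF).
  by rewrite gtnNdvd // pE ltnS.
have hV m : h m%:R^-1 = m%:R^-1 by rewrite fmorphV rmorph_nat.
have tf_inj : injective tf by move=> x y /eqP; rewrite tofrac_eq => /eqP.
apply: tf_inj.
set q := chain _ _ _ _ _.
transitivity (fchain (tf 'X) (tf ('X * 'X%:P)) n n : K * K).1.
  rewrite /fchain -[LHS]/(tf q.1, tf q.2).1 -rmorph_chain.
  congr fst; apply: eq_chain => i /andP[i0 ile] /=; first exact: (hV i).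
  rewrite rmorphN rmorph1 /ratio -natrB // -(natrD _ n i).
  have ni : (n + i)%:R != 0 :> K.
    by apply: nz; rewrite addn_gt0 i0 orbT -addnn leq_add2l.
  apply/eqP; rewrite eq_sym -[X in _ == X]divr1 eqr_div ?oner_eq0 // mulr1 mulN1r.
  rewrite -addr_eq0 natr1 -natrD -(rmorph_nat h) fmorph_eq0 -(dvdn_pcharf pF).
  by rewrite addSn addnCA subnK // addnn -pE.
rewrite fchain_diag // rmorph_prod; apply: eq_bigr => m _ /=.
rewrite -exprVn.
have -> : m.+1%:R^-1 = tf (m.+1%:R^-1)%:P%:P :> K by rewrite -hV.
rewrite !(rmorphD, rmorphM, rmorphXn, rmorph1) /=; ring.
Qed.

(** * Extracting the number of entries equal to 2 *)

(** Expanding the product chooses in each factor either the constant (k_i = 1)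
    or the linear term (k_i = 2), and the degree counts the latter. *)
Lemma coef_prod_affine (R : comNzRingType) (r a : nat) (x y : 'I_r -> R) :
  (\prod_(i < r) ((x i)%:P + (y i)%:P * 'X))`_a =
  \sum_(k : {ffun 'I_r -> 'I_3} |
      [forall i : 'I_r, ((k i : nat) == 1%N) || ((k i : nat) == 2%N)]
      && (#|[set i : 'I_r | (k i : nat) == 2%N]| == a))
    \prod_(i < r) (if (k i : nat) == 2%N then y i else x i).
Proof.
pose G i (j : 'I_3) : {poly R} :=
  if (j : nat) == 1%N then (x i)%:P else if (j : nat) == 2%N then (y i)%:P * 'X else 0.
rewrite (eq_bigr (fun i => \sum_j G i j)) => [|i _]; last first.
  by rewrite !big_ord_recl big_ord0 /G /= add0r addr0.
rewrite bigA_distr_bigA coef_sum [RHS]big_mkcond; apply: eq_bigr => k _.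
case: (boolP [forall i, _]) => [/forallP k12|] /=; last first.
  rewrite negb_forall => /existsP[i]; rewrite negb_or => /andP[k1 k2].
  by rewrite (bigD1 i) //= /G (negPf k1) (negPf k2) mul0r coef0.
have -> : \prod_i G i (k i) = (\prod_(i < r) (if (k i : nat) == 2%N then y i else x i))%:P
    * 'X^#|[set i : 'I_r | (k i : nat) == 2%N]|.
  rewrite -sum1_card expr_sum [X in _ * X]big_mkcond rmorph_prod -big_split /=.
  apply: eq_bigr => i _; rewrite inE /G.
  by have /orP[/eqP->|/eqP->] := k12 i; rewrite /= ?mulr1.
by rewrite coefCM coefXn eq_sym; case: eqP; rewrite ?mulr1 ?mulr0.
Qed.

Lemma coef_isum (R : comNzRingType) (p r N a : nat) (w e : nat -> R) :
  (isum p r N (fun i m => (w m)%:P + (e i)%:P * 'X * (w m)%:P ^+ 2))`_a =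
  \sum_(k : {ffun 'I_r -> 'I_3} |
      [forall i : 'I_r, ((k i : nat) == 1%N) || ((k i : nat) == 2%N)]
      && (#|[set i : 'I_r | (k i : nat) == 2%N]| == a))
    (\prod_(i < r | (k i : nat) == 2%N) e i) *
    \sum_(m : {ffun 'I_r -> 'I_p} |
        [forall i : 'I_r, (0 < m i < N)%N] && increasing p r m)
      \prod_(i < r) w (m i) ^+ k i.
Proof.
rewrite /isum coef_sum.
under eq_bigr => m _.
  under eq_bigr => i _ do rewrite mulrAC -rmorphXn -rmorphM.
  rewrite coef_prod_affine; over.
rewrite exchange_big /=; apply: eq_bigr => k /andP[/forallP k12 _].
rewrite mulr_sumr; apply: eq_bigr => m _.
rewrite [X in _ = X * _]big_mkcond -big_split /=; apply: eq_bigr => i _.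
by have /orP[/eqP->|/eqP->] := k12 i; rewrite /= ?mul1r.
Qed.

Lemma prod_alternating (R : comPzRingType) (r : nat) (A : {set 'I_r}) :
  \prod_(i in A) (2%:R * (-1) ^+ i.+1) =
  2%:R ^+ #|A| * (-1) ^+ #|[set i in A | odd i.+1]| :> R.
Proof.
rewrite big_split prodr_const /=; congr (_ * _).
rewrite -prodr_const [RHS]big_mkcond [LHS]big_mkcond; apply: eq_bigr => i _.
by rewrite inE -signr_odd /=; case: (i \in A); case: (odd i).
Qed.

(** The coefficient of Y^a in [isum_char].  The condition 2m < p on the entries
    becomes m < (p - 1)/2 + 1 because p is odd. *)
Lemma sum_char (F : fieldType) (p r a : nat) : p \in [pchar F] -> odd p ->
  \sum_(k : {ffun 'I_r -> 'I_3} |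
      [forall i : 'I_r, ((k i : nat) == 1%N) || ((k i : nat) == 2%N)]
      && (#|[set i : 'I_r | (k i : nat) == 2%N]| == a))
    (2%:R ^+ a * (-1) ^+ #|[set i : 'I_r | odd i.+1 && ((k i : nat) == 2%N)]| - 1)
    * \sum_(m : {ffun 'I_r -> 'I_p} |
        [forall i : 'I_r, (1 <= m i)%N && (2 * m i < p)%N]
        && increasing p r m)
      \prod_(i < r) ((m i)%:R ^+ k i)^-1 = 0 :> F.
Proof.
move=> pF oddp.
have /(congr1 (fun P : {poly F} => P`_a)) := isum_char F p r pF oddp.
pose w m : F := m%:R^-1.
have -> : isum p r p./2.+1 (fun i m =>
     (m%:R^-1)%:P + 2%:R * (-1) ^+ i.+1 * 'X * (m%:R^-1)%:P ^+ 2) =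
   isum p r p./2.+1 (fun i m =>
     (w m)%:P + (2%:R * (-1) ^+ i.+1 : F)%:P * 'X * (w m)%:P ^+ 2).
  apply: eq_bigr => m _; apply: eq_bigr => i _.
  by rewrite rmorphM rmorph_nat rmorphXn rmorphN1.
have -> : isum p r p./2.+1 (fun i m =>
     (m%:R^-1)%:P + 'X * (m%:R^-1)%:P ^+ 2) =
   isum p r p./2.+1 (fun i m => (w m)%:P + (1 : F)%:P * 'X * (w m)%:P ^+ 2).
  by apply: eq_bigr => m _; apply: eq_bigr => i _; rewrite mul1r.
rewrite !coef_isum => /eqP; rewrite -subr_eq0 -sumrB => /eqP E0; rewrite -[RHS]E0 {E0}.
apply: eq_bigr => k /andP[_ /eqP ka].
rewrite -mulrBl; congr ((_ - _) * _).
- rewrite (eq_bigl (fun i => i \in [set i | (k i : nat) == 2%N])) => [|i]; last by rewrite inE.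
  rewrite prod_alternating ka; congr (_ * _ ^+ #|pred_of_set _|).
  by apply/setP=> i; rewrite !inE andbC.
- by rewrite big1.
apply: eq_big => [m|m _]; last by apply: eq_bigr => i _; rewrite exprVn.
congr andb; apply: eq_forallb => i; congr andb.
move: (nat_of_ord (m i)) => x; rewrite -[in LHS](odd_double_half p) oddp.
by rewrite -mul2n add1n ltnS leq_pmul2l.
Qed.

(** * Passage to the quotient ring *)

(** A name for evaluation at p, on which the morphism structure is declared. *)
Definition coord (p : primeT) (f : prodFp) : 'F_(val p) := f p.

Fact coord_is_zmod_morphism p : zmod_morphism (coord p).
Proof. by []. Qed.
Fact coord_is_monoid_morphism p : monoid_morphism (coord p).
Proof. by []. Qed.
HB.instance Definition _ p :=
  GRing.isZmodMorphism.Build prodFp 'F_(val p) (coord p) (coord_is_zmod_morphism p).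
HB.instance Definition _ p :=
  GRing.isMonoidMorphism.Build prodFp 'F_(val p) (coord p) (coord_is_monoid_morphism p).

(* With 0-based indices, position [i.+1] is the 1-based index of [k i]. *)
Theorem theorem1p2 (r a : nat) (hr : (1 <= r)%N) (ha : (a <= r)%N) :
  \sum_(k : {ffun 'I_r -> 'I_3} |
      [forall i : 'I_r, ((k i : nat) == 1%N) || ((k i : nat) == 2%N)]
      && (#|[set i : 'I_r | (k i : nat) == 2%N]| == a))
    (2%:R ^+ a * (-1) ^+ #|[set i : 'I_r | odd i.+1 && ((k i : nat) == 2%N)]| - 1)
      * zetaA2 (fun i => nat_of_ord (k i))
  = 0 :> ringA.
Proof.
pose pi : {rmorphism prodFp -> ringA} := \pi_{ideal_quot sumFp}%qT.
transitivity (pi (\sum_(k : {ffun 'I_r -> 'I_3} |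
      [forall i : 'I_r, ((k i : nat) == 1%N) || ((k i : nat) == 2%N)]
      && (#|[set i : 'I_r | (k i : nat) == 2%N]| == a))
    (2%:R ^+ a * (-1) ^+ #|[set i : 'I_r | odd i.+1 && ((k i : nat) == 2%N)]| - 1)
      * zeta2_mod (fun i => nat_of_ord (k i)))).
  rewrite rmorph_sum; apply: eq_bigr => k _.
  by rewrite rmorphM rmorphB rmorphM !rmorphXn rmorphN1 rmorph1 rmorph_nat.
rewrite -(rmorph0 pi); apply/toA_eqP.
(* Only the prime 2 may be exceptional. *)
apply: (@sub_finite_set _ _ [set p | val p = 2%N]%classic); last first.
  apply: (@sub_finite_set _ _ [set exist (fun p => prime p) 2%N isT]%classic) => //.
  by move=> p /= p2; apply: val_inj.
move=> p /=; apply: contraNP => p2; apply/eqP.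
rewrite -[LHS]/(coord p _) -[RHS]/0 rmorph_sum.
rewrite -[RHS](@sum_char _ (val p) r a (pchar_Fp (valP p))); last first.
  by case: (even_prime (valP p)).
apply: eq_bigr => k _.
by rewrite rmorphM rmorphB rmorphM !rmorphXn rmorphN1 rmorph1 rmorph_nat.
Qed.
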